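(* Let $M$ be an integer $n\times n$ matrix with $\det M>1$. For $i=1,\dots,n$ let $(\mathbb{Z},\sigma^{(i)})$ be the one-dimensional lattice with unit weights and connection $\sigma^{(i)}:E(\mathbb{Z})\to O(d_i)$, and let $\hat\sigma=\sigma^{(1)}\otimes\cdots\otimes\sigma^{(n)}$ be the product connection on $\mathbb{Z}^n$; assume $\hat\sigma$ is $M\mathbb{Z}^n$-proper. Then the connection heat kernel of the connection discrete torus $(\mathbb{Z}^n/M\mathbb{Z}^n,\hat\sigma^{Q_{M\mathbb{Z}^n}})$ satisfies, for all $x=(x_1,\dots,x_n),y=(y_1,\dots,y_n)\in\mathbb{Z}^n$, $$H_t^{\hat{\sigma}^{Q_{M\mathbb{Z}^n}}}([x],[y])=\sum_{a\in M\mathbb{Z}^n}\prod_{i=1}^{n}\left((-1)^{|y_i+a_i-x_i|} \sum_{k\ge 0}\frac{C_{2k}^{k+|y_i+a_i-x_i|}}{k!} \Big(-\frac{t}{2n}\Big)^k\right)\sigma^{(1)}_{P_{x_1\rightarrow y_1+a_1}}\otimes \cdots\otimes \sigma^{(n)}_{P_{x_n\rightarrow y_n+a_n}},$$ where $\sigma^{(i)}_{P_{x_i\to y_i+a_i}}$ is the signature of the unique path from $x_i$ to $y_i+a_i$ in $(\mathbb{Z},\sigma^{(i)})$.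
   Context: A connection assigns to each ordered pair of adjacent vertices $(u,v)$ a matrix $\sigma_{uv}\in O(d)$ with $\sigma_{vu}=\sigma_{uv}^{-1}$. The normalized connection Laplacian of a weighted connection graph is $\mathcal{L}^{\sigma}=I-(D^{\sigma})^{-1/2}A^{\sigma}(D^{\sigma})^{-1/2}$ ($D^{\sigma}$ block diagonal with blocks $d(u)I_d$, $d(u)=\sum_{v\sim u}w_{uv}$; $A^{\sigma}$ with block $w_{uv}\sigma_{uv}$ at adjacent $(u,v)$), and its connection heat kernel is $e^{-t\mathcal{L}^{\sigma}}$ with blocks indexed by vertex pairs. $\mathbb{Z}^n$ is the lattice ($x\sim y$ iff they differ by $\pm1$ in one coordinate, unit weights) with product connection $\hat\sigma_{(x_1,\dots,x_i,\dots,x_n)(x_1,\dots,y_i,\dots,x_n)}=I_{d_1}\otimes\cdots\otimes\sigma^{(i)}_{x_iy_i}\otimes\cdots\otimes I_{d_n}$ (Kronecker products). The additive group $M\mathbb{Z}^n$ acts on $\mathbb{Z}^n$ by translations, which are automorphisms of the underlying graph; $[x]=x+M\mathbb{Z}^n$. $\hat\sigma$ is $M\mathbb{Z}^n$-proper if whenever $[x]\neq[y]$, for all adjacent $v\in[x]$, $w\in[y]$ one has $\hat\sigma_{vw}=\hat\sigma_{xy}$. The quotient $(\mathbb{Z}^n/M\mathbb{Z}^n,\tilde w,\hat\sigma^{Q_{M\mathbb{Z}^n}})$ has vertices the classes $[x]$; $[x]\sim[y]$ iff some representatives are adjacent and $[x]\neq[y]$; $\tilde w_{[x],[y]}=\#\{a\in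 M\mathbb{Z}^n: x\sim y+a\}$; $\hat\sigma^{Q_{M\mathbb{Z}^n}}_{[x],[y]}=\hat\sigma_{xy}$ for adjacent representatives. Signature of a path $P:x_0\sim\cdots\sim x_m$: $\sigma_P=\sigma_{x_0x_1}\cdots\sigma_{x_{m-1}x_m}$ (identity if $m=0$). $C_m^j=\binom mj$, zero if $j>m$.
   Formalization: Added hypothesis: adjacent vertices of Z^n lie in different classes mod MZ^n (no standard basis vector is in MZ^n); without it the formula fails, e.g. n=2, M=diag(1,2), trivial connections, where the quotient degree is no longer 2n. *)

(* Defs.v *)
From HB Require Import structures.
From mathcomp Require Import all_boot all_order all_algebra generic_quotient.
From mathcomp Require Import mxtens zify.
From mathcomp Require Import finmap all_classical all_reals all_analysis.
From mathcomp Require Export summability.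

Set Implicit Arguments.
Unset Strict Implicit.
Unset Printing Implicit Defensive.

Import Order.TTheory GRing.Theory Num.Theory.
Import numFieldNormedType.Exports.

Local Open Scope classical_set_scope.
Local Open Scope ring_scope.
Local Open Scope quotient_scope.

Section Kronecker.
Variable R : pzRingType.

Fixpoint kdim (n : nat) : ('I_n -> nat) -> nat :=
  match n with
  | 0 => fun=> 1%N
  | n'.+1 => fun d => (d ord0 * kdim (fun i => d (lift ord0 i)))%N
  end.

(* kron A = A_0 *t (A_1 *t ( ... *t (A_(n-1) *t 1))), the last factor being
   the 1 x 1 identity. *)
Fixpoint kron (n : nat) :
    forall d : 'I_n -> nat, (forall i, 'M[R]_(d i)) -> 'M[R]_(kdim d) :=
  match n with
  | 0 => fun _ _ => 1%:M
  | n'.+1 => fun d A => tensmx (A ord0) (kron (fun i => A (lift ord0 i)))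
  end.

End Kronecker.

Section Connections.
Variable R : realType.

Definition orthogonal_mx (d : nat) (A : 'M[R]_d) : Prop := A *m A^T = 1%:M.

Definition is_connection (V : Type) (adj : rel V) (d : nat)
    (s : V -> V -> 'M[R]_d) : Prop :=
  forall u v, adj u v -> orthogonal_mx (s u v) /\ s v u = invmx (s u v).

Fixpoint signature (V : Type) (d : nat) (s : V -> V -> 'M[R]_d)
    (x : V) (p : seq V) : 'M[R]_d :=
  if p is y :: p' then s x y *m signature s y p' else 1%:M.

End Connections.

Section HeatKernel.
Variable R : realType.

Definition expmx (m : nat) (X : 'M[R]_m) : 'M[R]_m :=
  \matrix_(i, j) limn (series (fun k : nat => (X ^+ k) i j / k`!%:R)).

Record wcgraph (V : finType) (d : nat) := WCGraph {
  wc_adj : rel V;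
  wc_weight : V -> V -> R;
  wc_conn : V -> V -> 'M[R]_d
}.

Variables (V : finType) (d : nat) (G : wcgraph V d).

Definition wc_deg (u : V) : R := \sum_(v | wc_adj G u v) wc_weight G u v.

(* Blocks are ordered by the enumeration of V. *)
Definition conn_adjmx : 'M[R]_(\sum_(i < #|V|) d) :=
  \mxblock_(i < #|V|, j < #|V|)
    (if wc_adj G (enum_val i) (enum_val j)
     then wc_weight G (enum_val i) (enum_val j)
            *: wc_conn G (enum_val i) (enum_val j)
     else 0).

Definition conn_deg_invsqrt : 'M[R]_(\sum_(i < #|V|) d) :=
  \mxdiag_(i < #|V|) ((Num.sqrt (wc_deg (enum_val i)))^-1%:M : 'M[R]_d).

Definition conn_laplacian : 'M[R]_(\sum_(i < #|V|) d) :=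
  1%:M - conn_deg_invsqrt *m conn_adjmx *m conn_deg_invsqrt.

Definition conn_heat_kernel (t : R) (u v : V) : 'M[R]_d :=
  submxblock (expmx ((- t) *: conn_laplacian)) (enum_rank u) (enum_rank v).

End HeatKernel.

Definition Zadj : rel int := fun x y => `|x - y|%N == 1%N.

(* The vertices after x on the monotone path from x to y in the lattice Z. *)
Definition Zpath (x y : int) : seq int :=
  [seq x + sgz (y - x) * (k.+1)%:Z | k <- iota 0 `|y - x|%N].

Lemma Zpath_cons (x y : int) : x != y ->
  Zpath x y = (x + sgz (y - x)) :: Zpath (x + sgz (y - x)) y.
Proof.
move=> xy; rewrite /Zpath.
have [m E] : exists m, absz (y - x) = m.+1.
  by exists (absz (y - x)).-1; lia.
have xy' : x < y \/ y < x by lia.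
have -> : absz (y - (x + sgz (y - x)))%R = m.
  by case: xy' => ?; [rewrite gtr0_sgz|rewrite ltr0_sgz]; lia.
rewrite E /= mulr1; congr (_ :: _).
have -> : iota 1 m = map (addn 1) (iota 0 m) by rewrite -iotaDl.
rewrite -map_comp; apply/eq_in_map => k; rewrite mem_iota => hk /=; rewrite -addrA; congr (_ + _).
have -> : sgz (y - (x + sgz (y - x))) = sgz (y - x).
  by case: xy' => ?; [rewrite [sgz (y - x)]gtr0_sgz ?gtr0_sgz
                     |rewrite [sgz (y - x)]ltr0_sgz ?ltr0_sgz]; lia.
by rewrite add1n -(addn1 k.+1) PoszD mulrDr mulr1 addrC.
Qed.

Lemma ZpathP (x y : int) (p : seq int) :
  reflect [/\ path Zadj x p, uniq (x :: p) & last x p = y] (p == Zpath x y).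
Proof.
have Zpath_nil z : Zpath z z = [::] by rewrite /Zpath subrr.
have sgzE (z : int) : z != y ->
    (z < y /\ sgz (y - z) = 1) \/ (y < z /\ sgz (y - z) = -1).
  move=> zy; have [?|?] : z < y \/ y < z by lia.
    by left; rewrite gtr0_sgz; lia.
  by right; rewrite ltr0_sgz; lia.
apply: (iffP eqP) => [->{p}|[]].
  have [m] := ubnP (absz (y - x)); elim: m x => // m IH x lt_m.
  have [<-|xy] := eqVneq x y; first by rewrite Zpath_nil.
  rewrite Zpath_cons //; set z := x + _.
  have zE := sgzE _ xy; rewrite -/z in zE.
  have lt_z : (absz (y - z)%R < m)%N by rewrite /z; case: zE => -[? ->]; lia.
  have [p_z u_z l_z] := IH z lt_z.
  have xz : Zadj x z by rewrite /Zadj /z; case: zE => -[_ ->]; lia.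
  split => //=; first by rewrite xz.
  rewrite -/(uniq (z :: _)) u_z andbT inE negb_or; apply/andP; split.
    by apply/eqP => e; move: xz; rewrite /Zadj -e subrr.
  have [<-|zy] := eqVneq z y; first by rewrite Zpath_nil.
  apply/mapP => -[k _]; have := sgzE _ zy.
  by move=> -[] [? ->]; case: zE => -[? e']; rewrite /z e' in zy *; lia.
elim: p x => [|z p IH] x /=; first by move=> _ _ ->; rewrite Zpath_nil.
move=> /andP[xz pz] /andP[]; rewrite inE negb_or => /andP[_ xp] uz lz.
have ep := IH z pz uz lz.
suff [xy zE] : x != y /\ z = x + sgz (y - x).
  by rewrite Zpath_cons // -zE -ep.
have {}xz : (z == x + 1) || (z == x - 1) by move: xz; rewrite /Zadj; lia.
have xy : x != y.
  apply/eqP => exy; have zy : z != y by apply/eqP => ezy; lia.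
  move: xp; rewrite ep Zpath_cons // inE negb_or => /andP[+ _].
  by have [[? ->]|[? ->]] := sgzE _ zy; lia.
split=> //; have [zy|zy] := eqVneq z y.
  by have [[? ->]|[? ->]] := sgzE _ xy; lia.
move: xp; rewrite ep Zpath_cons // inE negb_or => /andP[+ _].
by have [[? ->]|[? ->]] := sgzE _ zy; have [[? ->]|[? ->]] := sgzE _ xy; lia.
Qed.

Definition lat_adj (n : nat) : rel 'cV[int]_n := fun x y =>
  [exists i, Zadj (x i 0) (y i 0)
             && [forall j, (j != i) ==> (x j 0 == y j 0)]].

(* At adjacent x, y exactly one tensor factor is not the identity. *)
Definition prod_conn (R : realType) (n : nat) (d : 'I_n -> nat)
    (s : forall i, int -> int -> 'M[R]_(d i)) (x y : 'cV[int]_n) :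
    'M[R]_(kdim d) :=
  kron (fun i => if x i 0 == y i 0 then 1%:M else s i (x i 0) (y i 0)).

Section Torus.
Variables (n : nat) (M : 'M[int]_n).

Definition sublat : pred 'cV[int]_n :=
  fun a => `[< exists z : 'cV[int]_n, a = M *m z >].

Definition lat_cong : rel 'cV[int]_n := fun x y => sublat (y - x).

Lemma lat_cong_refl : reflexive lat_cong.
Proof. by move=> x; apply/asboolP; exists 0; rewrite subrr mulmx0. Qed.

Lemma lat_cong_sym : symmetric lat_cong.
Proof.
suff sym x y : lat_cong x y -> lat_cong y x.
  by move=> x y; apply/idP/idP; exact: sym.
move=> /asboolP[z e]; apply/asboolP; exists (- z).
by rewrite mulmxN -e opprB.
Qed.

Lemma lat_cong_trans : transitive lat_cong.
Proof.
move=> y x w /asboolP[z e] /asboolP[z' e']; apply/asboolP; exists (z' + z).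
by rewrite mulmxDr -e -e' addrA subrK.
Qed.

Canonical lat_cong_equiv :=
  EquivRel lat_cong lat_cong_refl lat_cong_sym lat_cong_trans.

Hypothesis detM_gt1 : 1 < \det M.

(* detM_gt1 is recorded in the type because it makes torus finite. *)
Definition torus : Type := let _ := detM_gt1 in {eq_quot lat_cong}.

HB.instance Definition _ := Countable.copy torus {eq_quot lat_cong}.
HB.instance Definition _ := EqQuotient.copy torus {eq_quot lat_cong}.

Definition torus_code (c : torus) : 'cV['I_(`|\det M|.-1.+1)]_n :=
  \col_i inord `|(repr c i ord0 %% \det M)%Z|%N.

Definition torus_decode (v : 'cV['I_(`|\det M|.-1.+1)]_n) : torus :=
  \pi_torus (\col_i (v i 0 : nat)%:Z).

Lemma torus_codeK : cancel torus_code torus_decode.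
Proof.
move=> c; rewrite -[RHS]reprK; apply/eqquotP/asboolP.
have D_neq0 : \det M != 0 by rewrite gt_eqF // (lt_trans _ detM_gt1).
exists (\adj M *m \col_i (repr c i ord0 %/ \det M)%Z).
rewrite mulmxA mul_mx_adj mul_scalar_mx; apply/matrixP => i j; rewrite !mxE.
rewrite ord1 inordK; last first.
  rewrite prednK ?absz_gt0 // -ltz_nat !abszE.
  by rewrite ger0_norm ?modz_ge0 // ltz_mod.
rewrite abszE ger0_norm ?modz_ge0 // {1}(divz_eq (repr c i ord0) (\det M)).
by rewrite addrK mulrC.
Qed.

HB.instance Definition _ := @fintype.isFinite.Build torus _
  (pcan_enumP (can_pcan torus_codeK)).

Definition torus_class (x : 'cV[int]_n) : torus := \pi_torus x.

Variable R : realType.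
Variables (d : 'I_n -> nat) (s : forall i, int -> int -> 'M[R]_(d i)).

Definition sublat_proper : Prop :=
  forall x y v w : 'cV[int]_n,
    torus_class x != torus_class y -> lat_adj x y ->
    torus_class v = torus_class x -> torus_class w = torus_class y ->
    lat_adj v w -> prod_conn s v w = prod_conn s x y.

Definition adj_reps (u v : torus) : set ('cV[int]_n * 'cV[int]_n) :=
  [set p | [/\ torus_class p.1 = u, torus_class p.2 = v & lat_adj p.1 p.2]].

Definition torus_adj : rel torus :=
  fun u v => (u != v) && `[< adj_reps u v !=set0 >].

(* The number of a in M Z^n with x ~ y + a does not depend on the
   representatives x, y of the two classes. *)
Definition torus_weight (u v : torus) : R :=
  #|` fset_set [set a | sublat a /\ lat_adj (repr u) (repr v + a)] |%:R.

(* Under sublat_proper the value does not depend on the chosen adjacent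
   representatives; the default (0, 0) is reached only at non-adjacent u, v. *)
Definition torus_conn (u v : torus) : 'M[R]_(kdim d) :=
  let p := xget (0, 0) (adj_reps u v) in prod_conn s p.1 p.2.

Definition torus_graph : wcgraph R torus (kdim d) :=
  WCGraph torus_adj torus_weight torus_conn.

End Torus.

Definition Zheat_coef (R : realType) (n : nat) (t : R) (m : nat) : R :=
  (-1) ^+ m *
  limn (series (fun k : nat =>
    'C((2 * k)%N, (k + m)%N)%:R / k`!%:R * (- (t / (2 * n)%N%:R)) ^+ k)).

(* Main.v *)
(** On a lattice Z the connection is gauge-trivial, so in Z^n the signature of a
    walk from x to w only depends on its endpoints: it is the transport
    S(x, w), the Kronecker product of the one-dimensional signatures. Since the
    quotient is proper and has no loops, it has constant degree 2n, and lifting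
    walks shows that the ([x], v) block of (-t L)^k is the k-th iterate at x of
    the scalar lattice operator
      phi |-> (z |-> tau * sum_(z' ~ z) (phi z' - phi z)),  tau = t / 2n,
    applied to phi w = [w in v] S(x, w). The k-th iterate applied to a Dirac mass
    at w is k! times the k-th coefficient of a product over the coordinates of
    the one-dimensional heat series, because both sides obey the same recursion
    (Leibniz rule for the product, Pascal's rule for each factor). Finally k-th
    iterates only see points at distance at most k and grow at most like c^k, so
    replacing phi by its restriction to a finite set of lifts of [y] containing
    the ball of radius K around x costs at most the tail after K of exp(c). *)

Require Import Defs.
From mathcomp Require Import all_boot all_order all_algebra generic_quotient.
From mathcomp Require Import mxtens zify ring.
From mathcomp Require Import finmap all_classical all_reals all_analysis.

Set Implicit Arguments.
Unset Strict Implicit.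
Unset Printing Implicit Defensive.

Import Order.TTheory GRing.Theory Num.Theory.
Import numFieldNormedType.Exports.

Local Open Scope classical_set_scope.
Local Open Scope ring_scope.
Local Open Scope quotient_scope.

(** * Kronecker products and orthogonal matrices *)

Lemma eq_kron (R : pzRingType) (n : nat) (d : 'I_n -> nat)
    (A B : forall i, 'M[R]_(d i)) : (forall i, A i = B i) -> kron A = kron B.
Proof.
elim: n d A B => [|n IHn] d A B eqAB //=.
by rewrite eqAB (IHn _ _ (fun i => B (lift ord0 i))).
Qed.

Lemma kron_mul (R : comPzRingType) (n : nat) (d : 'I_n -> nat)
    (A B : forall i, 'M[R]_(d i)) :
  kron A *m kron B = kron (fun i => A i *m B i).
Proof.
elim: n d A B => [|n IHn] d A B /=; first by rewrite mulmx1.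
by rewrite tensmx_mul IHn.
Qed.

Lemma kron1 (R : comPzRingType) (n : nat) (d : 'I_n -> nat) :
  kron (fun i => 1%:M : 'M[R]_(d i)) = 1%:M.
Proof.
elim: n d => [|n IHn] d //=; rewrite IHn.
apply/matrixP => i j; case: (mxtens_indexP i) => i0 i1.
case: (mxtens_indexP j) => j0 j1; rewrite tensmxE !mxE -natrM mulnb.
by rewrite (can_eq (@mxtens_indexK _ _)).
Qed.

Lemma kron_norm_le1 (R : realDomainType) (n : nat) (d : 'I_n -> nat)
    (A : forall i, 'M[R]_(d i)) :
  (forall i p q, `|A i p q| <= 1) -> forall p q, `|kron A p q| <= 1.
Proof.
elim: n d A => [|n IHn] d A leA1 /= p q.
  by rewrite mxE; case: eqP; rewrite ?normr1 ?normr0 ?ler01.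
case: (mxtens_indexP p) => p0 p1; case: (mxtens_indexP q) => q0 q1.
by rewrite tensmxE normrM mulr_ile1 // IHn.
Qed.

(** The square of an entry is one of the nonnegative summands of a diagonal entry of [A *m A^T]. *)
Lemma orthogonal_mx_norm_le1 (R : realType) (d : nat) (A : 'M[R]_d) :
  orthogonal_mx A -> forall p q, `|A p q| <= 1.
Proof.
move=> oA p q; have sumA : \sum_j A p j * A^T j p = 1.
  by have /matrixP /(_ p p) := oA; rewrite !mxE eqxx.
rewrite -(@ler_pXn2r _ 2) ?nnegrE ?ler01 // expr1n -sumA (bigD1 q) //= mxE.
rewrite real_normK ?num_real // expr2 lerDl sumr_ge0 // => j _.
by rewrite mxE -expr2 sqr_ge0.
Qed.

Lemma orthogonal_mxM (R : realType) (d : nat) (A B : 'M[R]_d) :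
  orthogonal_mx A -> orthogonal_mx B -> orthogonal_mx (A *m B).
Proof.
rewrite /orthogonal_mx => oA oB.
by rewrite trmx_mul -mulmxA (mulmxA B) oB mul1mx.
Qed.

Lemma orthogonal_signature (R : realType) (V : Type) (adj : rel V) (d : nat)
    (s : V -> V -> 'M[R]_d) (x : V) (p : seq V) :
  is_connection adj s -> path adj x p -> orthogonal_mx (signature s x p).
Proof.
move=> s_conn; elim: p x => [|y p IHp] x /=.
  by rewrite /orthogonal_mx trmx1 mulmx1.
by move=> /andP[xy yp]; apply: orthogonal_mxM (IHp _ yp); case: (s_conn _ _ xy).
Qed.

(** * Path-independent transport on the lattice *)

Section LatticeTransport.
Variable R : realType.

Definition Ztransport (d : nat) (s : int -> int -> 'M[R]_d) (x y : int) :=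
  signature s x (Zpath x y).

Lemma Ztransport_refl (d : nat) (s : int -> int -> 'M[R]_d) (x : int) :
  Ztransport s x x = 1%:M.
Proof. by rewrite /Ztransport /Zpath subrr. Qed.

(** Gauge triviality of [Z]: either [z] is the first vertex on the way from [x] to [y], or the step
    leads away from [y]; then the path from [z] first returns to [x] and the two factors cancel. *)
Lemma ZtransportM (d : nat) (s : int -> int -> 'M[R]_d) (x z y : int) :
  is_connection Zadj s -> Zadj x z ->
  s x z *m Ztransport s z y = Ztransport s x y.
Proof.
move=> s_conn xz; have xz' : (z = x + 1) \/ (z = x - 1).
  by move: xz; rewrite /Zadj; lia.
have [oxz sx] := s_conn _ _ xz.
have [exy|xy] := eqVneq x y.
  subst y; rewrite Ztransport_refl /Ztransport Zpath_cons; last by lia.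
  have -> : z + sgz (x - z) = x.
    by case: xz' => ->; [rewrite ltr0_sgz|rewrite gtr0_sgz]; lia.
  rewrite /= /Zpath subrr /= mulmx1 sx mulmxV //.
  by case: (mulmx1_unit oxz).
have xyE : (x < y /\ sgz (y - x) = 1) \/ (y < x /\ sgz (y - x) = -1).
  have [?|?] : x < y \/ y < x by lia.
    by left; rewrite gtr0_sgz; lia.
  by right; rewrite ltr0_sgz; lia.
have [ez|nz] := eqVneq z (x + sgz (y - x)).
  by rewrite /Ztransport (Zpath_cons xy) /= -ez.
have zy : z != y by case: xyE => -[? e]; rewrite e in nz; lia.
have zE : z + sgz (y - z) = x.
  case: xyE => -[? e]; rewrite e in nz.
    by rewrite gtr0_sgz; lia.
  by rewrite ltr0_sgz; lia.
rewrite /Ztransport (Zpath_cons zy) /= zE mulmxA sx mulmxV ?mul1mx //.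
by case: (mulmx1_unit oxz).
Qed.

Lemma Ztransport_adj (d : nat) (s : int -> int -> 'M[R]_d) (x z : int) :
  is_connection Zadj s -> Zadj x z -> Ztransport s x z = s x z.
Proof. by move=> sc xz; rewrite -(ZtransportM z sc xz) Ztransport_refl mulmx1. Qed.

Lemma orthogonal_Ztransport (d : nat) (s : int -> int -> 'M[R]_d) (x y : int) :
  is_connection Zadj s -> orthogonal_mx (Ztransport s x y).
Proof.
move=> sc; apply: orthogonal_signature sc _.
by have /ZpathP[] : Zpath x y == Zpath x y by [].
Qed.

Variable n : nat.

(** Indexing the [2n] unit steps by a finite type turns sums over neighbours into bigops; the flag
    [true] marks the negative direction. *)
Definition lat_step (e : 'I_n * bool) : 'cV[int]_n :=
  (-1) ^+ e.2 *: delta_mx e.1 0.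

Lemma lat_stepE (e : 'I_n * bool) (i : 'I_n) :
  lat_step e i 0 = (-1) ^+ e.2 * (i == e.1)%:R.
Proof. by rewrite !mxE andbT. Qed.

Lemma lat_step_inj : injective lat_step.
Proof.
move=> [i b] [j c] /matrixP eqe.
have := eqe i 0; rewrite !lat_stepE /= eqxx mulr1.
by case: eqVneq => [<-|_]; case: b {eqe}; case: c.
Qed.

Lemma lat_adjP (x y : 'cV[int]_n) :
  reflect (exists e, y = x + lat_step e) (lat_adj x y).
Proof.
apply: (iffP existsP) => [[i /andP[xy /forallP eqxy]]|[[i b] ->]].
  have [b hb] : exists b : bool, y i 0 = x i 0 + (-1) ^+ b.
    move: xy; rewrite /Zadj => xy; exists (y i 0 < x i 0).
    by case: ltP => ?; rewrite /= ?expr1 ?expr0; lia.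
  exists (i, b); apply/matrixP => j k; rewrite ord1 mxE lat_stepE /=.
  case: eqVneq => [->|ij]; first by rewrite mulr1.
  by rewrite mulr0 addr0; have := eqxy j; rewrite ij => /eqP ->.
exists i; rewrite mxE lat_stepE /= eqxx mulr1; apply/andP; split.
  by rewrite /Zadj; case: b; rewrite /= ?expr1 ?expr0; lia.
apply/forallP => j; apply/implyP => /negPf ij.
by rewrite mxE lat_stepE /= ij mulr0 addr0.
Qed.

Variables (d : 'I_n -> nat) (s : forall i, int -> int -> 'M[R]_(d i)).
Hypothesis s_conn : forall i, is_connection Zadj (s i).

Definition lat_transport (x y : 'cV[int]_n) : 'M[R]_(kdim d) :=
  kron (fun i => Ztransport (s i) (x i 0) (y i 0)).

Lemma lat_transport_refl (x : 'cV[int]_n) : lat_transport x x = 1%:M.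
Proof.
rewrite -(@kron1 R n d).
by apply: eq_kron => i; rewrite Ztransport_refl.
Qed.

Let Zadj_step (x : 'cV[int]_n) e (i : 'I_n) :
  i = e.1 -> Zadj (x i 0) ((x + lat_step e) i 0).
Proof.
move=> ie; rewrite mxE lat_stepE ie eqxx /Zadj.
by case: e.2; rewrite /= ?expr1 ?expr0; lia.
Qed.

Let eq_step (x : 'cV[int]_n) e (i : 'I_n) :
  i <> e.1 -> (x + lat_step e) i 0 = x i 0.
Proof.
by move=> /eqP/negPf ie; rewrite mxE lat_stepE ie mulr0 addr0.
Qed.

(** A step moves a single coordinate, where [ZtransportM] applies; in the others the first factor is
    the identity. *)
Lemma lat_transportM (x y : 'cV[int]_n) e :
  lat_transport x (x + lat_step e) *m lat_transport (x + lat_step e) y =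
  lat_transport x y.
Proof.
rewrite /lat_transport kron_mul; apply: eq_kron => i.
have [/(Zadj_step x) xz|/(eq_step x) ->] := pselect (i = e.1).
  by rewrite (Ztransport_adj _ xz) // ZtransportM.
by rewrite Ztransport_refl mul1mx.
Qed.

Lemma prod_conn_step (x : 'cV[int]_n) e :
  prod_conn s x (x + lat_step e) = lat_transport x (x + lat_step e).
Proof.
apply: eq_kron => i.
have [/(Zadj_step x) xz|/(eq_step x) ->] := pselect (i = e.1).
  rewrite (Ztransport_adj _ xz) // ifF //.
  by apply/eqP => e0; move: xz; rewrite /Zadj -e0 subrr.
by rewrite Ztransport_refl eqxx.
Qed.

Lemma lat_transport_norm_le1 (x y : 'cV[int]_n) p q :
  `|lat_transport x y p q| <= 1.
Proof.
apply: kron_norm_le1 => i; apply: orthogonal_mx_norm_le1.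
exact: orthogonal_Ztransport.
Qed.

End LatticeTransport.

(** * Binomial identities and polynomial coefficients *)

Lemma leq_bin_expn2 (n m : nat) : ('C(n, m) <= 2 ^ n)%N.
Proof.
elim: n m => [|n IHn] [|m]; rewrite ?bin0 ?expn_gt0 //.
by rewrite binS expnS mul2n -addnn leq_add.
Qed.

(** Pascal's rule applied twice. At [m = 0] both neighbours have absolute value 1, and the symmetry
    of row [2j + 1] is needed as well. *)
Lemma bin_central_shift (j : nat) (m : int) :
  'C(2 * j.+1, j.+1 + absz m)%N =
  ('C(2 * j, j + absz (m + 1)%R) + 2 * 'C(2 * j, j + absz m) +
   'C(2 * j, j + absz (m - 1)%R))%N.
Proof.
have -> : (2 * j.+1 = (2 * j).+2)%N by lia.
have [m0|[p mp]] : m = 0 \/ exists p, absz m = p.+1.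
  by case: (eqVneq m 0) => ?; [left|right; exists (absz m).-1; lia].
  rewrite m0 add0r sub0r abszN /= !addn0 addn1 binS.
  have -> : 'C((2 * j).+1, j) = 'C((2 * j).+1, j.+1).
    by rewrite -bin_sub; [congr 'C(_, _)|]; lia.
  by rewrite binS; lia.
have hp : (absz (m + 1) = p.+2 /\ absz (m - 1) = p) \/
          (absz (m + 1) = p /\ absz (m - 1) = p.+2) by lia.
rewrite mp !addSn !addnS !binS.
by case: hp => -[-> ->]; rewrite ?addnS; lia.
Qed.

Lemma deriv_prod (R : comNzRingType) (n : nat) (p : 'I_n -> {poly R}) :
  (\prod_i p i)^`() =
  \sum_i \prod_j (if j == i then (p j)^`() else p j).
Proof.
elim: n p => [|n IHn] p; first by rewrite !big_ord0 derivC.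
rewrite big_ord_recl derivM IHn big_ord_recl; congr (_ + _).
  by rewrite big_ord_recl eqxx.
rewrite mulr_sumr; apply: eq_bigr => i _; rewrite [RHS]big_ord_recl /=.
by congr (_ * _); apply: eq_bigr => j _; rewrite (inj_eq lift_inj).
Qed.

(** Serves to multiply identities between truncated series, which hold only in low degrees. *)
Lemma eq_coefMl (R : nzRingType) (p q r : {poly R}) (k : nat) :
  (forall j, (j <= k)%N -> p`_j = q`_j) -> (p * r)`_k = (q * r)`_k.
Proof.
by move=> pq; rewrite !coefM; apply: eq_bigr => j _; rewrite pq // -ltnS.
Qed.

(** * Majorization of polynomials by exponential series *)

Section ExpDomination.
Variable R : realType.
Implicit Types (p q : {poly R}) (a b : R).

Lemma exp_coeffD a b (k : nat) :
  exp_coeff (a + b) k = \sum_(j < k.+1) exp_coeff b j * exp_coeff a (k - j)%N.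
Proof.
rewrite /exp_coeff /= exprDn mulr_suml; apply: eq_bigr => j _.
have jk : (j <= k)%N by rewrite -ltnS.
have nz m : m`!%:R != 0 :> R by rewrite pnatr_eq0 -lt0n fact_gt0.
have -> : k`!%:R = 'C(k, j)%:R * j`!%:R * (k - j)`!%:R :> R.
  by rewrite -!natrM -mulnA bin_fact.
have nC : 'C(k, j)%:R != 0 :> R by rewrite pnatr_eq0 -lt0n bin_gt0.
by rewrite -mulr_natr; field; rewrite nC !nz.
Qed.

(** Majorization by the power series [exp (a T)]: under products the exponents add up, and the part
    of degree at least [m] is controlled by a tail of [expR a]. *)
Definition exp_dominated a p := forall k, `|p`_k| <= exp_coeff a k.

Lemma exp_dominatedM a b p q :
  exp_dominated a p -> exp_dominated b q -> exp_dominated (a + b) (p * q).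
Proof.
move=> ap bq k; rewrite coefM addrC exp_coeffD.
apply: le_trans (ler_norm_sum _ _ _) _; apply: ler_sum => j _.
by rewrite normrM ler_pM.
Qed.

Lemma exp_dominated1 : exp_dominated 0 1.
Proof.
move=> k; rewrite coef1 /exp_coeff /= expr0n.
by case: k => [|k]; rewrite /= ?normr1 ?normr0 ?mul0r // fact0 divr1.
Qed.

Lemma exp_dominated_prod a (n : nat) (p : 'I_n -> {poly R}) :
  (forall i, exp_dominated a (p i)) -> exp_dominated (a *+ n) (\prod_i p i).
Proof.
elim: n p => [|n IHn] p ap; first by rewrite big_ord0; exact: exp_dominated1.
by rewrite big_ord_recl mulrS; apply: exp_dominatedM => //; exact: IHn.
Qed.

Lemma exp_coeff_tail a (m k : nat) : 0 <= a -> (m <= k)%N ->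
  \sum_(m <= j < k) exp_coeff a j <= expR a - series (exp_coeff a) m.
Proof.
move=> a0 mk; rewrite -sub_series_geq // lerD2r.
apply: nondecreasing_cvgn_le; last exact: is_cvg_series_exp_coeff.
by apply: nondecreasing_series => j _ _; exact: exp_coeff_ge0.
Qed.

Lemma exp_dominated_tail a p (m : nat) : 0 <= a -> exp_dominated a p ->
  `|p.[1] - \sum_(j < m) p`_j| <= expR a - series (exp_coeff a) m.
Proof.
move=> a0 ap; have [N pN mN] : exists2 N, (size p <= N)%N & (m <= N)%N.
  by exists (maxn (size p) m); rewrite ?leq_maxl ?leq_maxr.
rewrite (horner_coef_wide _ pN).
under eq_bigr do rewrite expr1n mulr1.
rewrite -!(big_mkord xpredT (fun j => p`_j)) (big_cat_nat (leq0n m) mN) /= addrAC subrr.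
rewrite add0r; apply: le_trans (ler_norm_sum _ _ _) _.
by apply: le_trans (exp_coeff_tail a0 mN); apply: ler_sum => j _.
Qed.

Lemma exp_tail_cvg0 a : expR a - series (exp_coeff a) m @[m --> \oo] --> (0 : R).
Proof.
rewrite -[X in _ --> X](subrr (expR a)).
by apply: cvgB; [exact: cvg_cst|exact: is_cvg_series_exp_coeff].
Qed.

End ExpDomination.

(** * Heat series of a point mass on the lattice *)

Section HeatCoefficients.
Variables (R : realType) (tau : R).

(* The coefficient of T^m in (tau (T - 2 + T^-1))^j / j!, where
   T - 2 + T^-1 is the square of T^(1/2) - T^(-1/2). *)
Definition Zheat_term (m : int) (j : nat) : R :=
  (-1) ^+ absz m * ('C((2 * j)%N, (j + absz m)%N)%:R / j`!%:R * (- tau) ^+ j).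

(** Multiplication of the [j]-th term by [tau (T - 2 + T^-1)]: the alternating signs turn the
    three-term rule [bin_central_shift] into a second difference. *)
Lemma Zheat_term_rec (m : int) (j : nat) :
  Zheat_term m j.+1 *+ j.+1 =
  tau * \sum_(b : bool) (Zheat_term (m - (-1) ^+ b) j - Zheat_term m j).
Proof.
have sgn (k : int) : (-1) ^+ absz (k + 1) = - (-1) ^+ absz k :> R.
  rewrite -signr_odd -[in RHS]signr_odd.
  have -> : odd (absz (k + 1)) = ~~ odd (absz k) by lia.
  by case: (odd _); rewrite ?expr0 ?expr1 ?opprK.
have sgn' (k : int) : (-1) ^+ absz (k - 1) = - (-1) ^+ absz k :> R.
  by rewrite -[X in - (-1) ^+ absz X](subrK 1) sgn opprK.
rewrite big_bool /= expr1 expr0 opprK /Zheat_term bin_central_shift sgn sgn'.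
have nz : j`!%:R != 0 :> R by rewrite pnatr_eq0 -lt0n fact_gt0.
have nz1 : j.+1%:R != 0 :> R by rewrite pnatr_eq0.
rewrite factS (natrM _ j.+1) 2!natrD (natrM _ 2) exprS -mulr_natr.
by field; rewrite nz nat1r nz1.
Qed.

Lemma Zheat_term0 (m : int) : Zheat_term m 0 = (m == 0)%:R.
Proof.
rewrite /Zheat_term muln0 expr0 fact0 divr1 mulr1 add0n.
case: eqVneq => [->|m0]; first by rewrite expr0 mul1r.
by rewrite bin_small ?mulr0 // absz_gt0.
Qed.

(** The constant 4 comes from bounding a binomial coefficient in row [2j] by [2^(2j) = 4^j]. *)
Lemma Zheat_term_norm_le (m : int) (j : nat) :
  `|Zheat_term m j| <= exp_coeff (4 * `|tau|) j.
Proof.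
rewrite /Zheat_term /exp_coeff /= !normrM normrX normrN1 expr1n mul1r.
rewrite normrX normrN normr_nat normfV normr_nat mulrAC exprMn.
rewrite ler_wpM2r ?invr_ge0 ?ler0n // ler_wpM2r ?exprn_ge0 //.
by rewrite -natrX ler_nat (leq_trans (leq_bin_expn2 _ _)) // expnM.
Qed.

Lemma cvg_Zheat_term (m : int) : cvgn (series (Zheat_term m)).
Proof.
apply: normed_cvg; apply: series_le_cvg (Zheat_term_norm_le m) _ => //.
  by move=> j; apply: exp_coeff_ge0; rewrite mulr_ge0.
exact: is_cvg_series_exp_coeff.
Qed.

(** Truncation keeps the generating series polynomial, so that differentiation is algebraic; the
    value at 1 is the [K]-th partial sum. *)
Definition Zheat_poly (K : nat) (m : int) : {poly R} :=
  \poly_(j < K) Zheat_term m j.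

Lemma Zheat_poly_dominated (K : nat) (m : int) :
  exp_dominated (4 * `|tau|) (Zheat_poly K m).
Proof.
move=> k; rewrite coef_poly; case: ifP => _; first exact: Zheat_term_norm_le.
by rewrite normr0 exp_coeff_ge0 // mulr_ge0.
Qed.

Lemma Zheat_poly1 (K : nat) (m : int) :
  (Zheat_poly K m).[1] = series (Zheat_term m) K.
Proof.
rewrite horner_poly seriesEord; apply: eq_bigr => j _.
by rewrite expr1n mulr1.
Qed.

Section Multidimensional.
Variable n : nat.
Implicit Types (x w z : 'cV[int]_n) (phi psi : 'cV[int]_n -> R).

Definition lat_laplacian phi x : R :=
  tau * \sum_(e : 'I_n * bool) (phi (x + lat_step e) - phi x).

Definition lat_heat_poly (K : nat) z : {poly R} :=
  \prod_i Zheat_poly K (z i 0).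

(** The left side is a coefficient of the derivative. Leibniz' rule differentiates one coordinate
    factor at a time, giving a second difference in that coordinate; [k.+1 < K] keeps the truncation
    out of sight. *)
Lemma lat_heat_poly_rec (K k : nat) z : (k.+1 < K)%N ->
  (lat_heat_poly K z)`_k.+1 *+ k.+1 =
  tau * \sum_(e : 'I_n * bool)
    ((lat_heat_poly K (z - lat_step e))`_k - (lat_heat_poly K z)`_k).
Proof.
move=> kK; rewrite -coef_deriv deriv_prod coef_sum.
rewrite [X in tau * X](_ : _ = \sum_i \sum_b
    ((lat_heat_poly K (z - lat_step (i, b)))`_k - (lat_heat_poly K z)`_k)); last first.
  by rewrite pair_bigA; apply: eq_bigr => -[].
rewrite mulr_sumr; apply: eq_bigr => i _; rewrite (bigD1 i) //= eqxx.
rewrite (eq_bigr (fun j => Zheat_poly K (z j 0))); last by move=> j /negPf ->.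
(* The factors other than [i], which steps along coordinate [i] leave unchanged. *)
set Q := \prod_(j | _) _.
have hz : lat_heat_poly K z = Zheat_poly K (z i 0) * Q.
  by rewrite /lat_heat_poly (bigD1 i).
have hb b : lat_heat_poly K (z - lat_step (i, b)) =
            Zheat_poly K (z i 0 - (-1) ^+ b) * Q.
  rewrite /lat_heat_poly (bigD1 i) //= !mxE !eqxx mulr1; congr (_ * _).
  by apply: eq_bigr => j /negPf ji; rewrite !mxE ji mulr0 subr0.
under eq_bigr do rewrite hb hz -coefB -mulrBl.
rewrite -coef_sum -mulr_suml -coefZ scalerAl.
apply: eq_coefMl => j jk; rewrite coef_deriv coefZ coef_sum coef_poly.
rewrite (leq_ltn_trans _ kK) // Zheat_term_rec; congr (_ * _).
apply: eq_bigr => b _; rewrite coefB !coef_poly.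
by rewrite (leq_ltn_trans jk) // ltnW.
Qed.

Lemma iter_laplacian_delta (K k : nat) w x : (k < K)%N ->
  iter k lat_laplacian (fun v => (v == w)%:R) x =
  k`!%:R * (lat_heat_poly K (w - x))`_k.
Proof.
elim: k x => [|k IHk] x kK /=.
  rewrite fact0 mul1r /lat_heat_poly coef0_prod.
  under eq_bigr do rewrite coef_poly kK Zheat_term0 !mxE subr_eq0.
  have [->|/eqP xw] := eqVneq x w; first by rewrite big1 // => i _; rewrite eqxx.
  apply/esym/eqP/prodf_eq0; apply: contrapT => noi.
  apply: xw; apply/matrixP => i j; rewrite ord1; apply/eqP/negPn/negP => xwi.
  by apply: noi; exists i => //; rewrite [w i 0 == _]eq_sym (negPf xwi).
rewrite factS natrM -mulrA mulrCA (mulr_natl _ k.+1) lat_heat_poly_rec //.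
rewrite /lat_laplacian mulrCA; congr (_ * _); rewrite mulr_sumr.
apply: eq_bigr => e _; rewrite !IHk ?(ltnW kK) // -mulrBr.
by rewrite opprD addrA.
Qed.

(** The partial sum adds the first [K] coefficients of a product, while the product of the
    one-dimensional partial sums is its value at 1. The two have the same limit. *)
Lemma cvg_lat_heat_coef w x :
  series (fun k => iter k lat_laplacian (fun v => (v == w)%:R) x / k`!%:R) K
    @[K --> \oo] -->
  \prod_i limn (series (Zheat_term (w i 0 - x i 0))).
Proof.
set a := 4 * `|tau| *+ n.
have a0 : 0 <= a by rewrite mulrn_wge0 // mulr_ge0.
have cvg_horner : (lat_heat_poly K (w - x)).[1] @[K --> \oo] -->
    \prod_i limn (series (Zheat_term (w i 0 - x i 0))).
  have -> : (fun K => (lat_heat_poly K (w - x)).[1]) =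
            (fun K => \prod_i series (Zheat_term (w i 0 - x i 0)) K).
    apply/funext => K; rewrite /lat_heat_poly horner_prod.
    by apply: eq_bigr => i _; rewrite Zheat_poly1 !mxE.
  apply: cvg_big => [|i _]; first exact: mul_continuous.
  exact: cvg_Zheat_term.
rewrite -[X in _ --> X]subr0.
(* The part of degree at least [K], which exponential domination sends to 0. *)
pose err K := (lat_heat_poly K (w - x)).[1] -
              \sum_(j < K) (lat_heat_poly K (w - x))`_j.
have -> : series (fun k =>
      iter k lat_laplacian (fun v => (v == w)%:R) x / k`!%:R) =
    (fun K => (lat_heat_poly K (w - x)).[1] - err K).
  apply/funext => K; rewrite /err opprB addrC subrK seriesEord.
  apply: eq_bigr => k _; rewrite (@iter_laplacian_delta K) //.
  by rewrite mulrAC divff ?mul1r // pnatr_eq0 -lt0n fact_gt0.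
apply: cvgB cvg_horner _; apply: norm_cvg0.
apply: (squeeze_cvgr _ (cvg_cst 0) (exp_tail_cvg0 a)); apply: nearW => K.
rewrite normr_ge0 /=; apply: exp_dominated_tail => //.
by apply: exp_dominated_prod => i; exact: Zheat_poly_dominated.
Qed.

End Multidimensional.
End HeatCoefficients.

(** * Linearity, growth and locality of the iterated Laplacian *)

Section LatticeLaplacian.
Variables (R : realType) (tau : R) (n : nat).
Implicit Types (x w : 'cV[int]_n) (phi psi : 'cV[int]_n -> R).

Notation Lap := (@lat_laplacian R tau n).

Lemma iter_laplacianS (k : nat) phi x :
  iter k.+1 Lap phi x =
  tau * \sum_(e : 'I_n * bool)
    (iter k Lap phi (x + lat_step e) - iter k Lap phi x).
Proof. by []. Qed.

Lemma iter_laplacian_sum (k : nat) (I : Type) (r : seq I) (c : I -> R)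
    (phi : I -> 'cV[int]_n -> R) x :
  iter k Lap (fun w => \sum_(i <- r) c i * phi i w) x =
  \sum_(i <- r) c i * iter k Lap (phi i) x.
Proof.
elim: k x => [|k IHk] x //; rewrite iter_laplacianS.
under eq_bigr do rewrite !IHk -sumrB.
rewrite exchange_big /= mulr_sumr; apply: eq_bigr => i _.
rewrite -iterS iter_laplacianS mulrCA; congr (_ * _); rewrite mulr_sumr.
by apply: eq_bigr => e _; rewrite mulrBr.
Qed.

Lemma iter_laplacianB (k : nat) phi psi x :
  iter k Lap (fun w => phi w - psi w) x = iter k Lap phi x - iter k Lap psi x.
Proof.
elim: k x => [|k IHk] x //; rewrite !iter_laplacianS -mulrBr -sumrB.
by congr (_ * _); apply: eq_bigr => e _; rewrite !IHk opprD addrACA opprD.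
Qed.

(** Sup-norm bound of the operator: [2n] neighbours, each contributing [|tau|] times a difference of
    two values. *)
Definition laplacian_bound : R := 4 * `|tau| *+ n.

Lemma laplacian_bound_ge0 : 0 <= laplacian_bound.
Proof. by rewrite mulrn_wge0 // mulr_ge0. Qed.

Lemma iter_laplacian_norm_le (k : nat) psi x :
  (forall w, `|psi w| <= 1) -> `|iter k Lap psi x| <= laplacian_bound ^+ k.
Proof.
move=> psi1; elim: k x => [|k IHk] x; first by rewrite expr0 psi1.
rewrite iter_laplacianS normrM exprS; move: (laplacian_bound ^+ k) IHk => c IHk.
have -> : laplacian_bound = `|tau| * \sum_(e : 'I_n * bool) 2.
  by rewrite sumr_const card_prod card_ord card_bool /laplacian_bound; ring.
rewrite -mulrA ler_wpM2l // mulr_suml.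
apply: le_trans (ler_norm_sum _ _ _) _; apply: ler_sum => e _.
by apply: le_trans (ler_normB _ _) _; rewrite mulr_natl mulr2n lerD.
Qed.

(** Lists all points whose values the [k]-th iterate at [x] can read; repetitions are harmless, only
    finiteness matters. *)
Fixpoint lat_reach (k : nat) x : seq 'cV[int]_n :=
  if k is k'.+1 then
    lat_reach k' x ++
    flatten [seq lat_reach k' (x + lat_step e) | e <- enum {: 'I_n * bool}]
  else [:: x].

Lemma iter_laplacian_local (k : nat) psi x :
  {in lat_reach k x, forall w, psi w = 0} -> iter k Lap psi x = 0.
Proof.
elim: k x => [|k IHk] x psi0; first by apply: psi0; rewrite inE.
rewrite iter_laplacianS big1 ?mulr0 // => e _.
rewrite !IHk ?subrr // => w wk; apply: psi0; rewrite mem_cat ?wk //.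
apply/orP; right; apply/flatten_mapP; exists e => //.
by rewrite mem_enum.
Qed.

End LatticeLaplacian.

(** * Blocks of the connection Laplacian of a finite graph *)

Section BlockLaplacian.
Variables (R : realType) (V : finType) (d : nat) (G : wcgraph R V d).

Lemma submxblock_mul (A B : 'M[R]_(\sum_(i < #|V|) d)) (u v : V) :
  submxblock (A *m B) (enum_rank u) (enum_rank v) =
  \sum_w submxblock A (enum_rank u) (enum_rank w) *m
         submxblock B (enum_rank w) (enum_rank v).
Proof.
rewrite -[in LHS](submxblockK A) -[in LHS](submxblockK B) mul_mxblock mxblockK.
rewrite (reindex (@enum_rank V)) //.
exact/onW_bij/enum_rank_bij.
Qed.

Lemma submxblock1 (u v : V) :
  submxblock (1%:M : 'M[R]_(\sum_(i < #|V|) d)) (enum_rank u) (enum_rank v) =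
  (u == v)%:R%:M.
Proof.
rewrite -mxdiagZ mxblockK (inj_eq enum_rank_inj) conform_mx_id.
by case: eqP => // _; rewrite raddf0.
Qed.

Lemma conn_laplacian_block (c : R) (u v : V) : 0 < c ->
  (forall w, wc_deg G w = c) ->
  submxblock (conn_laplacian G) (enum_rank u) (enum_rank v) =
  (u == v)%:R%:M -
  c^-1 *: (if wc_adj G u v then wc_weight G u v *: wc_conn G u v else 0).
Proof.
move=> c0 degc; rewrite /conn_laplacian submxblockB submxblock1; congr (_ - _).
rewrite /conn_deg_invsqrt /conn_adjmx mul_mxdiag_mxblock mul_mxblock_mxdiag.
rewrite mxblockK !enum_rankK !degc mul_scalar_mx mul_mx_scalar scalerA.
by rewrite -invfM -expr2 sqr_sqrtr // ltW.
Qed.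

Lemma conn_heat_kernelE (t : R) (u v : V) p q :
  conn_heat_kernel G t u v p q =
  limn (series (fun k =>
    submxblock (((- t) *: conn_laplacian G) ^+ k) (enum_rank u) (enum_rank v) p q
      / k`!%:R)).
Proof. by rewrite !mxE; under [in RHS]eq_fun do rewrite !mxE. Qed.

End BlockLaplacian.

(** * Lifting the torus Laplacian to the lattice *)

Section TorusBlocks.
Variables (R : realType) (n : nat) (M : 'M[int]_n) (detM_gt1 : 1 < \det M).
Variables (d : 'I_n -> nat) (s : forall i : 'I_n, int -> int -> 'M[R]_(d i)).
Hypothesis s_conn : forall i : 'I_n, is_connection Zadj (s i).
Hypothesis s_proper : sublat_proper detM_gt1 s.
Hypothesis no_loops : forall x y : 'cV[int]_n,
  lat_adj x y -> torus_class detM_gt1 x != torus_class detM_gt1 y.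

Notation cls := (torus_class detM_gt1).
Notation G := (torus_graph detM_gt1 s).
Implicit Types (x y w : 'cV[int]_n) (u v : torus detM_gt1).

Lemma torus_classP x y : reflect (sublat M (y - x)) (cls x == cls y).
Proof. by apply: (iffP eqP) => [/eqquotP|?]; last exact/eqquotP. Qed.

Lemma torus_class_repr u : cls (repr u) = u.
Proof. exact: reprK. Qed.

Lemma torus_classD x y z : cls x = cls y -> cls (x + z) = cls (y + z).
Proof.
move=> /eqP/torus_classP xy; apply/eqP/torus_classP.
by rewrite opprD addrACA subrr addr0.
Qed.

(** Translation lifts an edge of the quotient to a step from any prescribed representative;
    conversely [no_loops] makes every step descend to an edge. *)
Lemma torus_adjP x v :
  reflect (exists e, v = cls (x + lat_step e)) (torus_adj (cls x) v).
Proof.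
apply: (iffP andP) => [[_ /asboolP[[y w]]]|[e ->]].
  move=> [/= yx <- /lat_adjP[e ->]]; exists e.
  exact: torus_classD.
have xe : lat_adj x (x + lat_step e) by apply/lat_adjP; exists e.
by split; [exact: no_loops|apply/asboolP; exists (x, x + lat_step e)].
Qed.

Lemma torus_conn_step x e :
  torus_conn s (cls x) (cls (x + lat_step e)) =
  lat_transport s x (x + lat_step e).
Proof.
rewrite -prod_conn_step // /torus_conn.
have xe : lat_adj x (x + lat_step e) by apply/lat_adjP; exists e.
(* The default of [xget] is excluded, since [(x, x + lat_step e)] is a pair of adjacent
   representatives; properness handles any other choice. *)
case: xgetP => [[v w] -> [/= vx wx vw]|/(_ (x, x + lat_step e)) []] //.
by apply: s_proper => //; exact: no_loops.
Qed.

(** The translations counted by the weight correspond to the steps from [x0] into [v] through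
    [a = x0 + lat_step e - repr v]. *)
Lemma torus_weightE x v :
  torus_weight R (cls x) v = #|[pred e | cls (x + lat_step e) == v]|%:R.
Proof.
rewrite /torus_weight; congr (_%:R); set x0 := repr (cls x).
have x0E e : cls (x0 + lat_step e) = cls (x + lat_step e).
  by apply: torus_classD; exact: torus_class_repr.
pose f e := x0 + lat_step e - repr v.
have f_inj : injective f.
  by move=> e e' /addIr /addrI; exact: lat_step_inj.
rewrite (_ : mkset _ =
  [set` [fset f e | e in [pred e | cls (x + lat_step e) == v]]%fset]).
  by rewrite set_fsetK card_imfset //= cardE.
apply/seteqP; split => a /=.
  move=> [aM /lat_adjP[e ae]]; apply/imfsetP; exists e => /=; last first.
    by rewrite /f -ae addrC addKr.
  change (cls (x + lat_step e) == v).
  rewrite -x0E -ae -[v in _ == v]torus_class_repr eq_sym.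
  by apply/torus_classP; rewrite addrC addKr.
move=> /imfsetP[e ev ->].
have {}ev : cls (x0 + lat_step e) = v by rewrite x0E; apply/eqP.
split.
  by apply/torus_classP; rewrite torus_class_repr ev.
by apply/lat_adjP; exists e; rewrite /f addrC subrK.
Qed.

(** The [2n] steps from [x] are partitioned by the class they reach; [no_loops] ensures that none is
    lost. *)
Lemma torus_degE u : wc_deg G u = (2 * n)%:R.
Proof.
rewrite -(torus_class_repr u); set x := repr u.
transitivity (\sum_(e : 'I_n * bool) 1 : R); last first.
  by rewrite sumr_const card_prod card_ord card_bool mulnC.
rewrite (partition_big (fun e => cls (x + lat_step e)) (torus_adj (cls x))) /=.
  by apply: eq_bigr => v _; rewrite [LHS]torus_weightE sumr_const.
by move=> e _; apply/torus_adjP; exists e.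
Qed.

Lemma torus_edge_block x v :
  (if torus_adj (cls x) v then torus_weight R (cls x) v *: torus_conn s (cls x) v
   else 0) =
  \sum_(e | cls (x + lat_step e) == v) lat_transport s x (x + lat_step e).
Proof.
case: ifPn => [_|/torus_adjP nadj]; last first.
  by rewrite big_pred0 // => e; apply/eqP => ev; apply: nadj; exists e.
rewrite torus_weightE scaler_nat -sumr_const.
by apply: eq_bigr => e; rewrite inE => /eqP <-; rewrite torus_conn_step.
Qed.

Variable t : R.
Let tau := t / (2 * n)%:R.
Notation Lap := (@lat_laplacian R tau n).

(** The empty matrix has determinant 1. *)
Let n_gt0 : (0 < n)%N.
Proof.
rewrite lt0n; apply/eqP => n0; move: detM_gt1; subst n.
by rewrite det_mx00.
Qed.

(** The identity term of the Laplacian is spread evenly over the [2n] steps, each carrying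
    [tau = t / 2n]. *)
Lemma torus_laplacian_block x v :
  submxblock ((- t) *: conn_laplacian G) (enum_rank (cls x)) (enum_rank v) =
  tau *: \sum_e ((cls (x + lat_step e) == v)%:R *:
                   lat_transport s x (x + lat_step e) - (cls x == v)%:R%:M).
Proof.
have n2 : (2 * n)%:R != 0 :> R by rewrite pnatr_eq0 -lt0n muln_gt0.
have -> : submxblock ((- t) *: conn_laplacian G)
            (enum_rank (cls x)) (enum_rank v) =
          (- t) *: submxblock (conn_laplacian G)
            (enum_rank (cls x)) (enum_rank v).
  by apply/matrixP => p q; rewrite !mxE.
rewrite (@conn_laplacian_block _ _ _ _ (2 * n)%:R); last 2 first.
- by rewrite ltr0n muln_gt0.
- exact: torus_degE.
rewrite [X in _ - _ *: X]torus_edge_block sumrB sumr_const card_prod card_ord.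
rewrite card_bool (mulnC n 2) -[_%:M *+ _]scaler_nat scalerBr scalerBr !scalerA /tau.
rewrite divfK // scaleNr mulNr scaleNr opprK addrC; congr (_ *: _ - _).
by rewrite big_mkcond; apply: eq_bigr => e _; case: eqP => _;
  rewrite ?scale1r ?scale0r.
Qed.

Lemma torus_laplacian_mul x v (B : 'M[R]_(\sum_(i < #|(torus detM_gt1 : finType)|) kdim d)) :
  submxblock (((- t) *: conn_laplacian G) *m B)
    (enum_rank (cls x)) (enum_rank v) =
  tau *: \sum_e
    (lat_transport s x (x + lat_step e) *m
       submxblock B (enum_rank (cls (x + lat_step e))) (enum_rank v)
     - submxblock B (enum_rank (cls x)) (enum_rank v)).
Proof.
rewrite submxblock_mul.
under eq_bigr do rewrite torus_laplacian_block -scalemxAl mulmx_suml.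
rewrite -scaler_sumr exchange_big /=; congr (_ *: _); apply: eq_bigr => e _.
under eq_bigr do rewrite mulmxBl -scalemxAl mul_scalar_mx.
rewrite sumrB (bigD1 (cls (x + lat_step e))) //= eqxx scale1r.
rewrite big1 => [|w]; last by rewrite eq_sym => /negPf ->; rewrite scale0r.
rewrite addr0 (bigD1 (cls x)) //= eqxx scale1r.
rewrite big1 => [|w]; last by rewrite eq_sym => /negPf ->; rewrite scale0r.
by rewrite addr0.
Qed.

Lemma torus_laplacian_pow (k : nat) x v p q :
  submxblock (((- t) *: conn_laplacian G) ^+ k)
    (enum_rank (cls x)) (enum_rank v) p q =
  iter k Lap (fun w => (cls w == v)%:R * lat_transport s x w p q) x.
Proof.
elim: k x p => [|k IHk] x p.
  rewrite expr0 submxblock1 /= lat_transport_refl.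
  by case: eqP => _; rewrite !mxE ?mul1r ?mul0r ?mul0rn.
rewrite exprS torus_laplacian_mul iter_laplacianS mxE summxE.
congr (_ * _); apply: eq_bigr => e _; rewrite mxE [X in _ + X]mxE IHk.
congr (_ - _); rewrite mxE; under eq_bigr do rewrite IHk.
rewrite -iter_laplacian_sum; congr (iter k Lap _ _); apply/funext => w.
(* Change of base point: row [p] of the transport along the step combines the functions based at
   [x + lat_step e] into the one based at [x]. *)
rewrite -(lat_transportM s_conn x w e) mxE mulr_sumr.
by apply: eq_bigr => r _; rewrite mulrCA.
Qed.

End TorusBlocks.

Lemma limn_Zheat_term (R : realType) (n : nat) (t : R) (m : int) :
  limn (series (Zheat_term (t / (2 * n)%N%:R) m)) = Zheat_coef n t (absz m).
Proof.
set tau := t / _; apply: cvg_lim => //; rewrite /Zheat_coef.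
pose u k : R := 'C((2 * k)%N, (k + absz m)%N)%:R / k`!%:R * (- tau) ^+ k.
have eqT : series (Zheat_term tau m) = (fun K => (-1) ^+ absz m * series u K).
  by apply/funext => K; rewrite !seriesEord mulr_sumr.
(* The sign is its own inverse, so convergence passes from the signed series to the unsigned one. *)
have eqU : series u = (fun K => (-1) ^+ absz m * series (Zheat_term tau m) K).
  by apply/funext => K; rewrite eqT signrMK.
rewrite eqT; apply: cvgMl_tmp; rewrite -/u.
suff : cvgn (series u) by [].
by rewrite eqU; apply: is_cvgMl_tmp; exact: cvg_Zheat_term.
Qed.

(** * Convergence and comparison of Laplacian series *)

Section LaplacianSeries.
Variables (R : realType) (tau : R) (n : nat).
Notation Lap := (@lat_laplacian R tau n).
Notation D := (laplacian_bound tau n).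
Implicit Types (phi psi : 'cV[int]_n -> R) (x : 'cV[int]_n).

Lemma iter_laplacian_term_le (k : nat) psi x :
  (forall w, `|psi w| <= 1) -> `|iter k Lap psi x / k`!%:R| <= exp_coeff D k.
Proof.
move=> psi1; rewrite normrM normfV normr_nat /exp_coeff /=.
by rewrite ler_wpM2r ?invr_ge0 ?ler0n // iter_laplacian_norm_le.
Qed.

Lemma cvg_laplacian_series psi x : (forall w, `|psi w| <= 1) ->
  cvgn (series (fun k => iter k Lap psi x / k`!%:R)).
Proof.
move=> psi1; apply: normed_cvg.
apply: series_le_cvg (fun k => iter_laplacian_term_le k x psi1) _ => //.
  by move=> k; apply: exp_coeff_ge0; exact: laplacian_bound_ge0.
exact: is_cvg_series_exp_coeff.
Qed.

(* The terms of index below K cancel by locality, the others are dominated by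
   the exponential series. *)
Lemma laplacian_series_dist (K : nat) phi psi x :
  (forall w, `|phi w - psi w| <= 1) ->
  (forall k, (k < K)%N -> {in lat_reach k x, phi =1 psi}) ->
  cvgn (series (fun k => iter k Lap phi x / k`!%:R)) ->
  cvgn (series (fun k => iter k Lap psi x / k`!%:R)) ->
  `|limn (series (fun k => iter k Lap phi x / k`!%:R)) -
    limn (series (fun k => iter k Lap psi x / k`!%:R))| <=
  expR D - series (exp_coeff D) K.
Proof.
move=> le1 eqK cvphi cvpsi; rewrite -limB // -lim_norm; last exact: is_cvgB.
apply: limr_le; first by apply: is_cvg_norm; exact: is_cvgB.
exists K => // N /= KN.
have -> : (series (fun k => iter k Lap phi x / k`!%:R) -
           series (fun k => iter k Lap psi x / k`!%:R)) N =
    \sum_(K <= k < N) iter k Lap (fun w => phi w - psi w) x / k`!%:R.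
  rewrite fctE /series /= -sumrB (big_cat_nat (leq0n K) KN) /=.
  rewrite big_nat_cond big1 ?add0r.
    by apply: eq_bigr => k _; rewrite iter_laplacianB mulrBl.
  move=> k /andP[/andP[_ kK] _]; rewrite -mulrBl -iter_laplacianB.
  by rewrite iter_laplacian_local ?mul0r // => w /(eqK _ kK) ->; rewrite subrr.
apply: le_trans (ler_norm_sum _ _ _) _.
apply: le_trans (exp_coeff_tail (laplacian_bound_ge0 tau n) KN).
by apply: ler_sum => k _; exact: iter_laplacian_term_le.
Qed.

End LaplacianSeries.

#[local] Existing Instance totally_filter.

(** Convergence along [totally], the filter of finite subsets ordered by inclusion, makes the sum
    over the sublattice unconditional. *)
Theorem theorem7 (R : realType) (n : nat) (M : 'M[int]_n)
    (detM_gt1 : 1 < \det M)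
    (d : 'I_n -> nat) (s : forall i : 'I_n, int -> int -> 'M[R]_(d i))
    (s_conn : forall i : 'I_n, is_connection Zadj (s i))
    (s_proper : sublat_proper detM_gt1 s)
    (no_loops : forall x y : 'cV[int]_n,
       lat_adj x y -> torus_class detM_gt1 x != torus_class detM_gt1 y)
    (t : R) (x y : 'cV[int]_n) :
  partial_sum (fun a : {a : 'cV[int]_n | sublat M a} =>
    (\prod_(i < n) Zheat_coef n t (absz (y i 0 + val a i 0 - x i 0)%R)) *:
    kron (fun i : 'I_n =>
      signature (s i) (x i 0) (Zpath (x i 0) (y i 0 + val a i 0))))
  @ totally -->
  conn_heat_kernel (torus_graph detM_gt1 s) t
    (torus_class detM_gt1 x) (torus_class detM_gt1 y).
Proof.
pose tau := t / (2 * n)%:R; pose D := laplacian_bound tau n.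
apply/cvg_ballP => eps eps0.
have [K _ /(_ K (leqnn K)) tailK] :
    \forall K \near \oo, expR D - series (exp_coeff D) K < eps.
  have /cvgrPdist_lt /(_ eps eps0) := exp_tail_cvg0 D.
  apply: filterS => K; rewrite sub0r normrN; apply: le_lt_trans.
  exact: ler_norm.
(* The points within reach of the first [K] iterates at [x]; [A] keeps the differences [w - y] that
   lie in the sublattice, [insub] discarding the others. *)
pose reachK := flatten [seq lat_reach k x | k <- iota 0 K].
pose A := [fset a in
  pmap (insub : _ -> option {a : 'cV[int]_n | sublat M a})
       [seq w - y | w <- reachK]]%fset.
exists A => // J /= /fsubsetP AJ; split => // p q.
pose S (w : 'cV[int]_n) : R := lat_transport s x w p q.
pose phi (w : 'cV[int]_n) : R :=
  (torus_class detM_gt1 w == torus_class detM_gt1 y)%:R * S w.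
(* The restriction of [phi] to the lifts [y + a] with [a] in [J], written with point masses so that
   linearity applies. *)
pose psi (w : 'cV[int]_n) : R := \sum_(a : J) S (y + val (val a)) * (w == y + val (val a))%:R.
have psi_in (a : {a : 'cV[int]_n | sublat M a}) :
    a \in J -> psi (y + val a) = phi (y + val a).
  move=> aJ; rewrite /psi (bigD1 [` aJ]%fset) //= eqxx mulr1 big1 ?addr0.
    rewrite /phi (_ : (_ == _) = true) ?mul1r // eq_sym.
    by apply/torus_classP; rewrite addrC addKr; exact: valP.
  move=> b /negPf ba; rewrite (inj_eq (addrI _)) (inj_eq val_inj).
  by rewrite -[a]/(val [` aJ]%fset) (inj_eq val_inj) eq_sym ba mulr0.
have psi_out w : (forall a, a \in J -> w != y + val a) -> psi w = 0.
  move=> nw; rewrite /psi big1 // => a _.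
  by have /negPf -> := nw _ (fsvalP a); rewrite mulr0.
have phi_le1 w : `|phi w| <= 1.
  rewrite /phi normrM mulr_ile1 ?lat_transport_norm_le1 //.
  by rewrite normr_nat lern1 leq_b1.
have dist_le1 w : `|phi w - psi w| <= 1.
  have [[a aJ ->]|nw] := pselect (exists2 a, a \in J & w = y + val a).
    by rewrite psi_in // subrr normr0.
  by rewrite psi_out ?subr0 // => a aJ; apply/eqP => wa; apply: nw; exists a.
(* A reachable lift of the class of [y] comes from an element of [A], hence of [J]; off the lifts
   both functions vanish. *)
have eq_reach k : (k < K)%N -> {in lat_reach k x, phi =1 psi}.
  move=> kK w wk.
  have [wy|nwy] := boolP (torus_class detM_gt1 w == torus_class detM_gt1 y).
    move: (wy); rewrite eq_sym => /torus_classP wyM.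
    have -> : w = y + val (exist (fun a => sublat M a) _ wyM).
      by rewrite /= addrC subrK.
    rewrite psi_in //; apply: AJ; rewrite inE mem_pmap.
    apply/mapP; exists (w - y); last by rewrite insubT.
    apply/map_f/flatten_mapP; exists k => //.
    by rewrite mem_iota.
  rewrite psi_out /phi ?(negPf nwy) ?mul0r // => a aJ.
  apply: contraNneq nwy => ->; rewrite eq_sym; apply/torus_classP.
  by rewrite addrC addKr; exact: valP.
(* The series of [psi] is a finite combination of the heat series of point masses. *)
have cvg_psi : series (fun k => iter k (@lat_laplacian R tau n) psi x / k`!%:R) K
    @[K --> \oo] -->
    \sum_(a : J) S (y + val (val a)) *
      \prod_(i < n) Zheat_coef n t (absz (y i 0 + val (val a) i 0 - x i 0)%R).
  have -> : series (fun k => iter k (@lat_laplacian R tau n) psi x / k`!%:R) =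
    (fun K => \sum_(a : J) S (y + val (val a)) *
       series (fun k => iter k (@lat_laplacian R tau n)
                          (fun w => (w == y + val (val a))%:R) x / k`!%:R) K).
    apply/funext => N; under [RHS]eq_bigr do rewrite seriesEord mulr_sumr.
    rewrite exchange_big seriesEord /=; apply: eq_bigr => k _.
    rewrite /psi iter_laplacian_sum mulr_suml.
    by apply: eq_bigr => a _; rewrite mulrA.
  apply: cvg_big => [|a _]; first exact: add_continuous.
  apply: cvgMl_tmp.
  have := @cvg_lat_heat_coef R tau n (y + val (val a)) x.
  rewrite (eq_bigr (fun i =>
    Zheat_coef n t (absz (y i 0 + val (val a) i 0 - x i 0)%R))) //.
  by move=> i _; rewrite mxE limn_Zheat_term.
have -> : (\sum_(a : J)
    ((\prod_(i < n) Zheat_coef n t (absz (y i 0 + val (val a) i 0 - x i 0)%R)) *: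
    kron (fun i : 'I_n => signature (s i) (x i 0)
      (Zpath (x i 0) (y i 0 + val (val a) i 0))))) p q =
  limn (series (fun k => iter k (@lat_laplacian R tau n) psi x / k`!%:R)).
  rewrite (cvg_lim _ cvg_psi) // summxE; apply: eq_bigr => a _.
  rewrite mxE mulrC /S /lat_transport /Ztransport; congr (_ * _).
  by congr (fun_of_matrix _ p q); apply: eq_kron => i; rewrite mxE.
rewrite conn_heat_kernelE.
under eq_fun do rewrite torus_laplacian_pow //.
(* Convergence for [phi] follows from its bound by 1, for [psi] from its explicit limit. *)
apply: le_lt_trans tailK; apply: laplacian_series_dist => //.
  exact: cvg_laplacian_series.
by apply/cvg_ex; eexists; exact: cvg_psi.
Qed.
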